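(* There is an absolute constant $C$ such that, for all sufficiently large $n$, there is a connected graph $G$ on $n$ vertices with $$\operatorname{psd}(G)\ge n-C\sqrt n.$$ Consequently, $$\lim_{n\to\infty}\frac{\operatorname{PS}(n)}{n}=1.$$
   Context: All graphs are finite and simple. For a graph $G$ and vertices $u,v\in V(G)$: $u,v$ are similar if some automorphism of $G$ maps $u$ to $v$; they are removal-similar if $G-u\cong G-v$; they are pseudosimilar if they are removal-similar but not similar. A pseudosimilar mate of $v$ in $G$ is a vertex $u$ of $G$ such that $u,v$ are pseudosimilar in $G$. An active pseudosimilarity chain of length $k$ in $G$ is a sequence of distinct vertices $v_1,\ldots,v_k$ of $G$ such that, for each $j=0,\ldots,k-1$, writing $G_j=G-\{v_1,\ldots,v_j\}$ (so $G_0=G$), the vertex $v_{j+1}$ has a pseudosimilar mate in $G_j$. The pseudosimilarity depth $\operatorname{psd}(G)$ is the maximum $k$ such that $G$ has an active pseudosimilarity chain of length $k$ (the empty chain has length $0$). For $n\ge 1$, $\operatorname{PS}(n)=\max\{\operatorname{psd}(G): |V(G)|=n\}$. *)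

(* Defs.v *)
From HB Require Import structures.
From mathcomp Require Import all_boot all_order all_algebra.
From mathcomp Require Import all_classical all_reals all_analysis.

Set Implicit Arguments.
Unset Strict Implicit.
Unset Printing Implicit Defensive.

Record sgraph := SGraph {
  vertex :> finType;
  adj : rel vertex;
  adj_sym : symmetric adj;
  adj_irrefl : irreflexive adj
}.

Definition connected_graph (G : sgraph) : Prop :=
  0 < #|G| /\ forall x y : G, connect (@adj G) x y.

Definition is_iso (G H : sgraph) (f : G -> H) : Prop :=
  bijective f /\ forall x y : G, adj (f x) (f y) = adj x y.

Definition isomorphic (G H : sgraph) : Prop := exists f : G -> H, is_iso f.

Section Induced.
Variables (G : sgraph) (S : {set G}).

Definition induced_adj : rel {x : G | x \in S} :=
  fun x y => adj (val x) (val y).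

Lemma induced_sym : symmetric induced_adj.
Proof. by move=> x y; apply: adj_sym. Qed.

Lemma induced_irrefl : irreflexive induced_adj.
Proof. by move=> x; apply: adj_irrefl. Qed.

Definition induced : sgraph := SGraph induced_sym induced_irrefl.
End Induced.

Definition remove (G : sgraph) (D : {set G}) : sgraph := induced (~: D).

Definition similar (G : sgraph) (u v : G) : Prop :=
  exists f : G -> G, is_iso f /\ f u = v.

Definition removal_similar (G : sgraph) (u v : G) : Prop :=
  isomorphic (remove [set u]) (remove [set v]).

Definition pseudosimilar (G : sgraph) (u v : G) : Prop :=
  removal_similar u v /\ ~ similar u v.

Definition has_pseudosimilar_mate (G : sgraph) (v : G) : Prop :=
  exists u : G, pseudosimilar u v.

(* With 0-based indices, [take j s] lists the vertices deleted before the
   [j]-th entry of [s]; [x] is that entry seen as a vertex of the remaining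
   graph. *)
Definition active_chain (G : sgraph) (k : nat) (s : k.-tuple G) : Prop :=
  uniq s /\
  forall j : 'I_k, exists x : remove [set v in take j s],
    val x = tnth s j /\ has_pseudosimilar_mate x.

(* The entries of a chain are distinct, so no chain is longer than [#|G|] and
   the range of the maximum excludes no length. *)
Definition psd (G : sgraph) : nat :=
  \max_(k < #|G|.+1 | `[< exists s : k.-tuple G, active_chain s >]) k.

(* [psd G <= #|G|], so the range of the maximum excludes no value. *)
Definition PS (n : nat) : nat :=
  \max_(k < n.+1 | `[< exists G : sgraph, #|G| = n /\ psd G = k >]) k.

(* Main.v *)
Require Import Defs.
From HB Require Import structures.
From mathcomp Require Import all_boot all_order all_algebra.
From mathcomp Require Import all_classical all_reals all_analysis.
From mathcomp Require Import zify.

(** A single family of graphs, with depth at least [n - 11], proves both claims.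

    Fix a six-element clique, with vertices indexed by Z/6, and a long path
    [x_6, x_7, ...].  Join the clique vertex [c] to [x_v] exactly when [v - c]
    lies in [{0, 2, 3}] modulo 6.  Sending [x_v] to [x_{v+1}] and [c] to [c + 1]
    preserves adjacency wherever it is defined, so deleting the last vertex of
    the path gives a graph isomorphic to the one obtained by deleting its first
    vertex ([chiral_path_removal_similar]).

    These two vertices are nevertheless not similar
    ([chiral_path_not_similar]).  An automorphism preserves the clique, because
    in a graph of at least 12 vertices those of the clique have degree at least
    6, and those of the path have degree at most 5.  If it also sent the first
    vertex of the path to the last, it would reverse the path.  But along the
    path the neighbours of a clique vertex follow the periodic word 101100: its
    reversal contains 1101, and the word itself does not ([spoke_not_1101]).

    Hence the last vertex of the path has a pseudosimilar mate as soon as the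
    graph has at least 12 vertices.  Deleting it leaves the next smaller graph
    of the family, so the vertices can be deleted from the far end of the path
    until 11 remain ([chiral_path_psd]). *)

Import Order.TTheory GRing.Theory Num.Theory.
Import numFieldNormedType.Exports.
Local Open Scope classical_set_scope.
Local Open Scope ring_scope.

Set Implicit Arguments.
Unset Strict Implicit.
Unset Printing Implicit Defensive.

(** * Isomorphisms and vertex removal *)

Section Isomorphism.
Local Open Scope nat_scope.

Lemma is_iso_comp (G H K : sgraph) (f : G -> H) (g : H -> K) :
  is_iso f -> is_iso g -> is_iso (g \o f).
Proof.
move=> [fb fE] [gb gE]; split; first exact: bij_comp.
by move=> x y /=; rewrite gE fE.
Qed.

Lemma is_iso_inv {G H : sgraph} {f : G -> H} :
  is_iso f -> exists g : H -> G, [/\ is_iso g, cancel f g & cancel g f].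
Proof.
move=> [[g fK gK] fE]; exists g; split=> //; split; first by exists f.
by move=> x y; rewrite -fE !gK.
Qed.

Lemma isomorphic_sym (G H : sgraph) : isomorphic G H -> isomorphic H G.
Proof. by move=> [f /is_iso_inv [g [gi _ _]]]; exists g. Qed.

Lemma isomorphic_trans (H G K : sgraph) :
  isomorphic G H -> isomorphic H K -> isomorphic G K.
Proof. by move=> [f fi] [g gi]; exists (g \o f); apply: is_iso_comp. Qed.

(** The maps [f] and [g] are total on [G] and [H], but need only be inverse to
    each other, and [f] need only preserve adjacency, between [S] and [T]. *)
Lemma induced_isomorphic (G H : sgraph) (S : {set G}) (T : {set H})
    (f : G -> H) (g : H -> G) :
  {in S, forall x, f x \in T} -> {in T, forall y, g y \in S} ->
  {in S, cancel f g} -> {in T, cancel g f} ->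
  {in S &, forall x y, adj (f x) (f y) = adj x y} ->
  isomorphic (Defs.induced S) (Defs.induced T).
Proof.
move=> fT gS fK gK fE.
exists ((fun x => exist _ (f (val x)) (fT _ (valP x)))
  : Defs.induced S -> Defs.induced T).
split; last by move=> x y; apply: fE; apply: valP.
exists (fun y => exist _ (g (val y)) (gS _ (valP y))) => x; apply: val_inj => /=.
  by apply: fK; apply: valP.
by apply: gK; apply: valP.
Qed.

Lemma remove_isomorphic (G H : sgraph) (f : G -> H) (u : G) :
  is_iso f -> isomorphic (remove [set u]) (remove [set f u]).
Proof.
move=> fi; have [g [_ fK gK]] := is_iso_inv fi.
apply: (induced_isomorphic (f := f) (g := g)).
- by move=> x; rewrite !inE (can_eq fK).
- by move=> y; rewrite !inE => yu; rewrite (can2_eq gK fK).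
- by move=> x _; apply: fK.
- by move=> y _; apply: gK.
- by move=> x y _ _; apply: fi.2.
Qed.

Lemma has_pseudosimilar_mate_iso (G H : sgraph) (f : G -> H) (v : G) :
  is_iso f -> has_pseudosimilar_mate v -> has_pseudosimilar_mate (f v).
Proof.
move=> fi [u [uv nuv]]; exists (f u); split.
  apply: (@isomorphic_trans (remove [set u])).
    by apply: isomorphic_sym; apply: remove_isomorphic.
  by apply: isomorphic_trans uv _; apply: remove_isomorphic.
move=> [h [hi hE]]; apply: nuv.
have [g [gi fK _]] := is_iso_inv fi.
exists (g \o (h \o f)); split; last by rewrite /= hE fK.
by apply: is_iso_comp gi; apply: is_iso_comp.
Qed.

End Isomorphism.

(** * The chiral path *)

Section ChiralPath.
Local Open Scope nat_scope.

(** Adjacency between the clique vertex [c < 6] and the path vertex [v >= 6]: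
    [v - c] is 0, 2 or 3 modulo 6.  The term 6 keeps the truncated subtraction
    exact.  The cyclic gaps 2, 1, 3 of this set of residues are pairwise
    distinct, so that no reflection of Z/6 preserves it. *)
Definition spoke (c v : nat) : bool := (v + 6 - c) %% 6 \in [:: 0; 2; 3].

Lemma spoke_not_1101 c v : c <= 6 ->
  ~~ [&& spoke c v, spoke c v.+1, ~~ spoke c v.+2 & spoke c v.+3].
Proof.
move=> c6; rewrite /spoke.
have E k : (k + v + 6 - c) %% 6 = (k + (v + 6 - c) %% 6) %% 6.
  by rewrite modnDmr -addnA addnBA // (leq_trans c6) // leq_addl.
rewrite (E 1) (E 2) (E 3).
by case: (_ %% 6) (ltn_pmod (v + 6 - c) (isT : 0 < 6)) => [|[|[|[|[|[|]]]]]].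
Qed.

(** Adjacency on all of [nat]: the numbers below 6 form the clique, and the
    others, in their natural order, an infinite path. *)
Definition cp_adj (u v : nat) : bool :=
  if u < 6 then if v < 6 then u != v else spoke u v
  else if v < 6 then spoke v u else (v == u.+1) || (u == v.+1).

Lemma cp_adj_sym : symmetric cp_adj.
Proof.
move=> u v; rewrite /cp_adj; case: ltnP => u6; case: ltnP => v6 //.
  by rewrite eq_sym.
by rewrite orbC.
Qed.

Lemma cp_adj_irrefl : irreflexive cp_adj.
Proof. by move=> u; rewrite /cp_adj; case: ltnP => u6; lia. Qed.

(** The chiral path on [n] vertices: a clique on the vertices below 6, a path on
    the remaining ones, and the spokes. *)
Definition chiral_path (n : nat) : sgraph :=
  @SGraph 'I_n (fun u v => cp_adj u v)
    (fun u v => cp_adj_sym u v) (fun u => cp_adj_irrefl u).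

(** Rotation of the clique together with the shift of the path by one step. *)
Definition cp_shift (v : nat) : nat := if v < 6 then v.+1 %% 6 else v.+1.

(** The left inverse of [cp_shift]; it is a right inverse away from the first
    path vertex 6. *)
Definition cp_unshift (v : nat) : nat := if v < 6 then (v + 5) %% 6 else v.-1.

Lemma cp_shiftK : cancel cp_shift cp_unshift.
Proof.
move=> v; rewrite /cp_shift; case: (ltnP v 6) => v6; rewrite /cp_unshift.
  by rewrite ltn_mod /=; lia.
by rewrite ltnNge (leqW v6).
Qed.

Lemma cp_unshiftK v : v != 6 -> cp_shift (cp_unshift v) = v.
Proof.
move=> v_neq6; rewrite /cp_unshift; case: (ltnP v 6) => v6; rewrite /cp_shift.
  by rewrite ltn_mod /=; lia.
have -> : (v.-1 < 6) = false by lia.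
by lia.
Qed.

Lemma cp_adj_shift u v : cp_adj (cp_shift u) (cp_shift v) = cp_adj u v.
Proof.
have S6 w : 6 <= w -> cp_shift w = w.+1.
  by move=> w6; rewrite /cp_shift ltnNge w6.
have C6 w : w < 6 -> cp_shift w < 6.
  by rewrite /cp_shift => ->; rewrite ltn_mod.
have sp c w : c < 6 -> 6 <= w -> spoke (cp_shift c) w.+1 = spoke c w.
  move=> c6 w6; rewrite /spoke /cp_shift c6.
  have [->|c5] := eqVneq c 5.
    have -> : w.+1 + 6 - 6 %% 6 = w + 6 - 5 + 6 by lia.
    by rewrite modnDr.
  by have -> : c.+1 %% 6 = c.+1 by lia.
rewrite /cp_adj; case: (ltnP u 6) => u6; case: (ltnP v 6) => v6.
- by rewrite !C6 //; rewrite /cp_shift u6 v6; lia.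
- by rewrite (C6 u) // (S6 v) // [_ < 6]ltnNge (leqW v6) /= sp.
- by rewrite (C6 v) // (S6 u) // [_ < 6]ltnNge (leqW u6) /= sp.
- rewrite (S6 u) // (S6 v) // [u.+1 < 6]ltnNge [v.+1 < 6]ltnNge.
  by rewrite (leqW u6) (leqW v6).
Qed.

Lemma chiral_path_connected n : 6 <= n -> connected_graph (chiral_path n).
Proof.
move=> n6; split; first by rewrite card_ord; lia.
have n0 : 0 < n by lia.
pose o : chiral_path n := Ordinal n0.
have cs := sym_connect_sym (@adj_sym (chiral_path n)).
have Cc (c : 'I_n) : c < 6 -> connect (@adj (chiral_path n)) c o.
  move=> c6; have [->|co] := eqVneq c o; first exact: connect0.
  by apply: connect1; rewrite /= /cp_adj c6 /=.
suff co x : connect (@adj (chiral_path n)) x o.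
  by move=> x y; apply: connect_trans (co x) _; rewrite cs.
have [x6|x6] := ltnP (x : 'I_n) 6; first exact: Cc.
have cn : (x : 'I_n) %% 6 < n by apply: leq_trans n6; rewrite ltn_mod.
apply: connect_trans (Cc (Ordinal cn) _); last by rewrite /= ltn_mod.
apply: connect1; rewrite /= /cp_adj ltnNge x6 ltn_mod /= /spoke.
by rewrite !inE; lia.
Qed.

(** * The last vertex has a pseudosimilar mate *)

Section LastVertex.
Variables (N : nat) (N11 : 11 <= N).
Notation G := (chiral_path N.+1).

Let o6 : G := inord 6.
Let oN : G := ord_max.

Lemma chiral_path_removal_similar : removal_similar o6 oN.
Proof.
have v6 : (o6 : 'I_N.+1) = 6 :> nat by rewrite inordK //; lia.
have vN : (oN : 'I_N.+1) = N :> nat by [].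
have neq (u v : G) : (u != v) = ((u : 'I_N.+1) != (v : 'I_N.+1) :> nat) by [].
have shN (x : 'I_N.+1) : x != N :> nat -> cp_shift x < N.+1.
  by move=> xN; have := ltn_ord x; rewrite /cp_shift; case: (ltnP x 6); lia.
have uN (x : 'I_N.+1) : cp_unshift x < N.+1.
  by have := ltn_ord x; rewrite /cp_unshift; case: (ltnP x 6); lia.
apply: isomorphic_sym.
apply: (@induced_isomorphic G G _ _ (fun x : 'I_N.+1 => inord (cp_shift x))
   (fun x : 'I_N.+1 => inord (cp_unshift x))).
- move=> x; rewrite !inE !neq v6 vN => xN; rewrite inordK; last exact: shN.
  by rewrite /cp_shift; case: (ltnP (x : 'I_N.+1) 6); lia.
- move=> x; rewrite !inE !neq v6 vN => xN; rewrite inordK; last exact: uN.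
  by have := ltn_ord x; rewrite /cp_unshift; case: (ltnP (x : 'I_N.+1) 6); lia.
- move=> x; rewrite !inE !neq vN => xN; apply: val_inj.
  by rewrite /= (inordK (shN _ xN)) cp_shiftK inord_val.
- move=> x; rewrite !inE !neq v6 => xN; apply: val_inj.
  by rewrite /= (inordK (uN _)) cp_unshiftK // inord_val.
- move=> x y; rewrite !inE !neq => xN yN.
  by rewrite /= !inordK ?shN // cp_adj_shift.
Qed.

(** A clique vertex [c] has at least six neighbours: the other five clique
    vertices and the path vertex [c + 6].  A path vertex has at most five: two on
    the path and three in the clique. *)
Lemma chiral_path_iso_clique (f : G -> G) (c : 'I_N.+1) :
  is_iso f -> c < 6 -> (f c : 'I_N.+1) < 6.
Proof.
move=> [/bij_inj fI fE] c6; rewrite ltnNge; apply/negP => x6.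
pose s : seq nat := rcons [seq i : nat <- iota 0 6 | i != c] (c + 6).
have sz : size s = 6.
  by rewrite /s; case: (nat_of_ord c) c6 => [|[|[|[|[|[|]]]]]].
have us : uniq s.
  by rewrite /s; case: (nat_of_ord c) c6 => [|[|[|[|[|[|]]]]]].
have sN i : i \in s -> i < N.+1.
  by rewrite mem_rcons inE mem_filter mem_iota; lia.
have sc i : i \in s -> cp_adj c i.
  rewrite mem_rcons inE mem_filter mem_iota /= /cp_adj c6 => /orP[/eqP ->|].
    by rewrite ltnNge leq_addl /= /spoke -addnA addKn.
  by move=> /andP[ic ->]; rewrite eq_sym.
(* [t] lists the possible neighbours of [x]; a spoke at [x] ends at [x], [x - 2]
   or [x - 3] modulo 6. *)
pose x : nat := (f c : 'I_N.+1).
pose t : seq nat := [:: x.-1; x.+1; x %% 6; (x + 4) %% 6; (x + 3) %% 6].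
pose h i : nat := (f (inord i : 'I_N.+1) : 'I_N.+1).
have := @uniq_leq_size _ (map h s) t; rewrite size_map sz => H.
suff : 6 <= 5 by [].
apply: H.
  rewrite map_inj_in_uniq // => i j /sN iN /sN jN /val_inj /fI /(congr1 val).
  by rewrite /= !inordK.
move=> _ /mapP[i si ->].
have : adj (f c) (f (inord i : 'I_N.+1)).
  by rewrite fE /= inordK ?sN // sc.
rewrite -[adj _ _]/(cp_adj x (h i)) /cp_adj ltnNge x6 /= /t !inE.
case: ltnP => hi; rewrite /spoke ?inE; lia.
Qed.

Lemma chiral_path_not_similar : ~ Defs.similar o6 oN.
Proof.
move=> [f [fi f6]]; have [g [gi fK _]] := is_iso_inv fi.
have fX (x : 'I_N.+1) : 6 <= x -> 6 <= (f x : 'I_N.+1).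
  (* The inverse automorphism also preserves the clique. *)
  move=> x6; rewrite leqNgt; apply/negP => /(chiral_path_iso_clique gi).
  by rewrite fK ltnNge x6.
pose h i : nat := (f (inord i : 'I_N.+1) : 'I_N.+1).
have lt6F w : 6 <= w -> (w < 6) = false by lia.
have hN i : h i < N.+1 by apply: ltn_ord.
have hX i : 6 <= i <= 9 -> 6 <= h i.
  by move=> i6; apply: fX; rewrite inordK; lia.
have hE i j : i <= 9 -> j <= 9 -> cp_adj (h i) (h j) = cp_adj i j.
  move=> i9 j9; rewrite -[LHS]/(adj (f (inord i : 'I_N.+1)) (f (inord j : 'I_N.+1))).
  by rewrite fi.2 /= !inordK //; lia.
have hI i j : i <= 9 -> j <= 9 -> h i = h j -> i = j.
  move=> i9 j9 /val_inj /(bij_inj fi.1) /(congr1 val); rewrite /= !inordK //; lia.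
(* Two path vertices are adjacent exactly when they are consecutive; starting
   from the image of the first one, this determines the next three images. *)
have hX1 i j : 6 <= i <= 9 -> 6 <= j <= 9 ->
    (h j == (h i).+1) || (h i == (h j).+1) = (j == i.+1) || (i == j.+1).
  move=> i6 j6; have := hE i j; rewrite /cp_adj !lt6F ?hX //; lia.
have h6 : h 6 = N by rewrite /h -[f _]/(f o6) f6.
have h7 : h 7 = N.-1 by have := hX1 6 7 isT isT; have := hN 7; rewrite /=; lia.
have h8 : h 8 = N.-2.
  have := hX1 7 8 isT isT; have := hI 6 8 isT isT; rewrite /=; lia.
have h9 : h 9 = N - 3.
  have := hX1 8 9 isT isT; have := hI 7 9 isT isT; rewrite /=; lia.
have h0 : h 0 < 6 by apply: chiral_path_iso_clique; rewrite ?inordK.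
have hS i : 6 <= i <= 9 -> spoke (h 0) (h i) = spoke 0 i.
  move=> i6; have [i_ge6 i_le9] := andP i6.
  by have := hE 0 i isT i_le9; rewrite /cp_adj h0 (lt6F _ (hX _ i6)) (lt6F _ i_ge6).
(* The clique vertex 0 sees 6, 7, 8, 9 in the pattern 1011, so its image would
   see N-3, N-2, N-1, N in the pattern 1101. *)
have NE : N = (N - 3).+3 by rewrite -addn3 subnK //; apply: leq_trans N11.
have := spoke_not_1101 (N - 3) (ltnW h0).
move: (hS 6 isT) (hS 7 isT) (hS 8 isT) (hS 9 isT).
rewrite h6 h7 h8 h9 {1 2 3}NE /= => -> -> -> ->.
by rewrite /spoke.
Qed.

Lemma chiral_path_last_mate : has_pseudosimilar_mate oN.
Proof.
exists o6; split; first exact: chiral_path_removal_similar.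
exact: chiral_path_not_similar.
Qed.

End LastVertex.

(** * Depth of the chiral path *)

(** If the vertices left after removing [S] are those up to [v], the rest is a
    copy of the chiral path on [v + 1] vertices, with last vertex [v]. *)
Lemma chiral_path_remove_mate n (S : {set chiral_path n}) (v : 'I_n) :
  11 <= v ->
  (forall x : 'I_n, ((x : chiral_path n) \in ~: S) = (x <= v)) ->
  exists x : remove S, val x = v /\ has_pseudosimilar_mate x.
Proof.
move=> v11 SE; have vn := ltn_ord v.
have wP (i : 'I_v.+1) : (widen_ord vn i : chiral_path n) \in ~: S.
  by rewrite SE; apply: (ltn_ord i).
pose f (i : chiral_path v.+1) : remove S := exist _ (widen_ord vn i) (wP i).
have gP (x : remove S) : (val x : 'I_n) < v.+1 by rewrite ltnS -SE; apply: valP.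
exists (f ord_max); split; first exact: val_inj.
apply: (has_pseudosimilar_mate_iso (f := f)); last exact: chiral_path_last_mate.
split=> //; exists (fun x => Ordinal (gP x)) => x; first exact: val_inj.
by apply: val_inj; apply: val_inj.
Qed.

Lemma chiral_path_psd n : n <= psd (chiral_path n) + 11.
Proof.
have [n11|n11] := leqP n 11; first exact: leq_trans n11 (leq_addl _ _).
case: n n11 => // N N11.
pose k := N.+1 - 11.
have kn : k < #|chiral_path N.+1|.+1 by rewrite card_ord; lia.
suff H : exists s : k.-tuple (chiral_path N.+1), active_chain s.
  have : k <= psd (chiral_path N.+1).
    apply: (@leq_bigmax_cond _ _ (fun i : 'I__ => nat_of_ord i) (Ordinal kn)).
    exact/asboolP.
  by rewrite /k; lia.
(* The chain deletes N, N-1, ..., 11, in this order. *)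
pose d i : chiral_path N.+1 := inord (N - i) : 'I_N.+1.
have dE i : (d i : 'I_N.+1) = N - i :> nat by rewrite inordK //; lia.
have sz : size (mkseq d k) == k by rewrite size_mkseq.
exists (Tuple sz); split.
  rewrite /= map_inj_in_uniq ?iota_uniq // => i j; rewrite !mem_iota => ik jk.
  by move=> /(congr1 (fun x : 'I_N.+1 => nat_of_ord x)); rewrite !dE; lia.
move=> j; have jk := ltn_ord j.
rewrite (tnth_nth (d 0)) /= nth_mkseq //.
apply: chiral_path_remove_mate => //.
- by rewrite dE; lia.
- move=> x; rewrite !inE dE /mkseq -map_take take_iota.
  have -> : minn j k = j by lia.
  apply/negP/idP => [H|xj].
    rewrite leqNgt; apply/negP => jx; apply: H; apply/mapP.
    exists (N - x); first by have := ltn_ord x; rewrite mem_iota; lia.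
    by apply: ord_inj; rewrite dE; have := ltn_ord x; lia.
  by move=> /mapP[i]; rewrite mem_iota => ij xd; move: xj; rewrite xd dE; lia.
Qed.

End ChiralPath.

(** * The extremal function *)

Section Extremal.
Local Open Scope nat_scope.

Lemma psd_le_card (G : sgraph) : psd G <= #|G|.
Proof. by apply/bigmax_leqP => k _; rewrite -ltnS. Qed.

Lemma PS_le n : PS n <= n.
Proof. by apply/bigmax_leqP => k _; rewrite -ltnS. Qed.

Lemma psd_le_PS (G : sgraph) : psd G <= PS #|G|.
Proof.
have kn : psd G < #|G|.+1 by rewrite ltnS psd_le_card.
apply: (@leq_bigmax_cond _ _ (fun i : 'I__ => nat_of_ord i) (Ordinal kn)).
by apply/asboolP; exists G.
Qed.

Lemma PS_ge n : n <= PS n + 11.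
Proof.
apply: leq_trans (chiral_path_psd n) _; rewrite leq_add2r.
by rewrite -[X in PS X](card_ord n); apply: (psd_le_PS (chiral_path n)).
Qed.

End Extremal.

Theorem theorem5p4 (R : realType) :
  (exists C : R, exists N : nat, forall n : nat, (N <= n)%N ->
     exists G : sgraph,
       [/\ #|G| = n,
           connected_graph G &
           n%:R - C * Num.sqrt n%:R <= (psd G)%:R])
  /\ ((PS n)%:R / n%:R : R) @[n --> \oo] --> (1 : R).
Proof.
split.
  exists 11, 6 => n n6; exists (chiral_path n); split.
  - exact: card_ord.
  - exact: chiral_path_connected.
  - rewrite lerBlDr; apply: (@le_trans _ _ ((psd (chiral_path n))%:R + 11)).
      by rewrite -natrD ler_nat chiral_path_psd.
    have n1 : 1 <= n%:R :> R by rewrite ler1n; exact: leq_trans n6.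
    have := ler_wsqrtr n1; rewrite sqrtr1 => sqrt_ge1.
    by rewrite lerD2l ler_peMr.
apply: (@squeeze_cvgr _ _ _ _ (fun n => 1 - 11 * n%:R^-1) (fun=> 1)).
- near=> n.
  have n0 : 0 < n%:R :> R by rewrite ltr0n; near: n; exists 1.
  rewrite ler_pdivrMr // mul1r ler_nat PS_le andbT.
  rewrite ler_pdivlMr // mulrBl mul1r mulfVK ?gt_eqF //.
  by rewrite lerBlDr -natrD ler_nat PS_ge.
- rewrite -[X in _ --> X]subr0 -[X in _ - X](mulr0 11).
  apply: cvgB; first exact: cvg_cst.
  apply: cvgM; first exact: cvg_cst.
  apply: (gtr0_cvgV0 _).2; last exact: cvgr_idn.
  by near=> n; rewrite ltr0n; near: n; exists 1.
- exact: cvg_cst.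
Unshelve. all: by end_near.
Qed.
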